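(* Let $d\ge1$, $I=[0,1)^d$, and let $S\subset\mathbb{R}^d$ be such that $I+S$ is a cube tiling of $\mathbb{R}^d$, i.e. the cubes $I+s$, $s\in S$, are pairwise disjoint and their union is $\mathbb{R}^d$. Then for every $t\in S$ and every $\varepsilon\in\{-1,1\}^d$ there is a set $J\subseteq[d]$ of odd cardinality such that the vector $t'=t+\sum_{i\in J}\varepsilon_ie_i$ belongs to $S$, where $e_1,\dots,e_d$ is the standard basis of $\mathbb{R}^d$.
   Context: $[d]=\{1,\dots,d\}$. *)

(* Defs.v *)
From mathcomp Require Import all_boot all_order all_algebra.
From mathcomp Require Import all_classical reals.

Set Implicit Arguments.
Unset Strict Implicit.
Unset Printing Implicit Defensive.

Import Order.TTheory GRing.Theory Num.Theory.

Local Open Scope classical_set_scope.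
Local Open Scope ring_scope.

(* Vectors of R^d are row vectors; the coordinate set [d] is 'I_d. *)

Definition unit_cube (R : realType) (d : nat) : set 'rV[R]_d :=
  [set x | forall i, 0 <= x 0 i < 1].

Definition cube_at (R : realType) (d : nat) (s : 'rV[R]_d) : set 'rV[R]_d :=
  [set x + s | x in @unit_cube R d].

Definition cube_tiling (R : realType) (d : nat) (S : set 'rV[R]_d) : Prop :=
  trivIset S (@cube_at R d) /\ \bigcup_(s in S) cube_at s = setT.

(* Main.v *)
Require Import Defs.
From mathcomp Require Import all_boot all_order all_algebra.
From mathcomp Require Import all_classical reals.
From mathcomp Require Import lra.

(** The corner [p] of the cube at [t] singled out by [eps] is seen from the
    [2 ^ d] orthants around it.  For a set [K] of directions, the point [p]
    moved infinitesimally in the negative direction in the coordinates of [K]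
    still lies in exactly one cube of the tiling, at [f K] say.  If [p] is
    interior to the cube at [f K] in some direction [i], then [f] does not change
    when [i] is toggled in [K]; so such [K] cancel in [\sum_K (-1) ^ #|K| = 0].
    The remaining [K] are those for which [f K = p - \sum_(i in K) e_i], one of
    them giving [t], so another one, of opposite parity, must occur as well. *)

Local Open Scope classical_set_scope.
Local Open Scope ring_scope.

Import Order.TTheory GRing.Theory Num.Theory.

Lemma sum_sign_reversing (T : finType) (P : pred T) (w : T -> int) (g : T -> T) :
    involutive g -> (forall x, P (g x) = P x) ->
    (forall x, P x -> w (g x) = - w x) ->
  \sum_(x | P x) w x = 0.
Proof.
move=> gK Pg wg.
have E : \sum_(x | P x) w x = - \sum_(x | P x) w x.
  rewrite {1}(reindex_inj (inv_inj gK)) /= -sumrN.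
  by apply: eq_big => // x; rewrite Pg => /wg.
by lra.
Qed.

Definition toggle (T : finType) (i : T) (K : {set T}) : {set T} :=
  [set j | (j \in K) (+) (j == i)]%SET.

Lemma toggleK (T : finType) (i : T) : involutive (toggle T i).
Proof. by move=> K; apply/setP => j; rewrite !inE -addbA addbb addbF. Qed.

Lemma odd_toggle (T : finType) (i : T) (K : {set T}) :
  odd #|toggle T i K| = ~~ odd #|K|.
Proof.
rewrite (cardsD1 i (toggle _ _ _)) (cardsD1 i K) !inE eqxx addbT.
suff -> : (toggle T i K :\ i = K :\ i)%SET by case: (i \in K); rewrite ?negbK.
by apply/setP => j; rewrite !inE; case: eqP => //= _; rewrite addbF.
Qed.

Lemma odd_symdiff (T : finType) (A B : {set T}) :
  odd #|[set i | (i \in A) (+) (i \in B)]%SET| = odd #|A| (+) odd #|B|.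
Proof.
rewrite -(cardsID B A) -(cardsID A B) -(cardsID A [set i | _]%SET).
rewrite (finset.setIC B A) !oddD.
have -> : ([set i | (i \in A) (+) (i \in B)] :&: A = A :\: B)%SET.
  by apply/setP => i; rewrite !inE; case: (i \in A); case: (i \in B).
have -> : ([set i | (i \in A) (+) (i \in B)] :\: A = B :\: A)%SET.
  by apply/setP => i; rewrite !inE; case: (i \in A); case: (i \in B).
by case: (odd _); case: (odd _); case: (odd _).
Qed.

Section Orthants.
Variables (R : realType) (d : nat).
Implicit Types (S : set 'rV[R]_d) (s x p : 'rV[R]_d) (K : {set 'I_d}).

(** Points whose left germ (for [left] true) or right germ lies in [[a, a + 1)]: taking left germs
    moves the closed end to the right. *)
Definition unit_interval_at (left : bool) (a x : R) : bool :=
  if left then a < x <= a + 1 else a <= x < a + 1.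

(* Says that [x], moved infinitesimally in the negative direction in the
   coordinates of [K], belongs to the cube at [s]. *)
Definition germ_in K s x : Prop :=
  forall i, unit_interval_at (i \in K) (s 0 i) (x 0 i).

Lemma cube_atP s x : cube_at s x <-> germ_in finset.set0 s x.
Proof.
split=> [[y /= Hy <-] i|H].
  by move: (Hy i); rewrite inE /= mxE; lra.
exists (x - s); last by rewrite subrK.
by move=> i; move: (H i); rewrite inE /= !mxE; lra.
Qed.

Lemma germ_in_unique S K s s' x : cube_tiling S -> S s -> S s' ->
  germ_in K s x -> germ_in K s' x -> s = s'.
Proof.
move=> [tS _] Ss Ss' H H'; apply: (tS) => //.
(* An actual common point of both cubes: in the directions of [K], the infinitesimal move back from
   [x] is replaced by a move to the larger of the two lower ends. *)
exists (\row_i if i \in K then Num.max (s 0 i) (s' 0 i) else x 0 i).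
split; apply/cube_atP => i; move: (H i) (H' i); rewrite /unit_interval_at inE mxE;
  case: (i \in K) => //; case: (leP (s 0 i) (s' 0 i)); lra.
Qed.

Definition replace_coord x (i : 'I_d) (c : R) : 'rV[R]_d :=
  \row_j if j == i then c else x 0 j.

Lemma germ_in_replace K s x i c : i \notin K ->
  germ_in K s (replace_coord x i c) <->
  s 0 i <= c < s 0 i + 1 /\
  forall j, j != i -> unit_interval_at (j \in K) (s 0 j) (x 0 j).
Proof.
move=> iK; split=> [H|[Hi Hj] j]; last first.
  rewrite mxE; case: (eqVneq j i) => [->|/Hj //].
  by rewrite (negbTE iK).
split=> [|j ji]; first by move: (H i); rewrite mxE eqxx (negbTE iK).
by move: (H j); rewrite mxE (negbTE ji).
Qed.

Lemma germ_in_setU1 K s x i : i \notin K ->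
  germ_in (i |: K)%SET s x <->
  s 0 i < x 0 i <= s 0 i + 1 /\
  forall j, j != i -> unit_interval_at (j \in K) (s 0 j) (x 0 j).
Proof.
move=> iK; split=> [H|[Hi Hj] j]; last first.
  rewrite !inE; case: (eqVneq j i) => [->|/Hj //]; exact: Hi.
split=> [|j ji]; first by move: (H i); rewrite !inE eqxx.
by move: (H j); rewrite !inE (negbTE ji).
Qed.

(* Along a line in direction [i] the cubes cut unit intervals, and consecutive
   ones must abut; hence closing them on the other side still covers. *)
Lemma germ_in_exists S K x : cube_tiling S -> exists2 s, S s & germ_in K s x.
Proof.
move=> hS; have [n] := ubnP #|K|; elim: n K x => // n IHn K x.
have [->|[i iK]] := set_0Vmem K.
  move=> _; have : (\bigcup_(s in S) cube_at s) x by rewrite hS.2.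
  by move=> [s Ss /cube_atP Hs]; exists s.
rewrite (cardsD1 i) iK ltnS => Kn.
set K' := (K :\ i)%SET in Kn *.
have iK' : i \notin K' by rewrite !inE eqxx.
have EK : K = (i |: K')%SET by rewrite finset.setD1K.
(* By induction, half-open unit intervals cover the line through [x] in direction [i]; by [sep]
   below, two of them that meet have the same lower end. *)
have cover c : exists s, [/\ S s, s 0 i <= c < s 0 i + 1 &
    forall j, j != i -> unit_interval_at (j \in K') (s 0 j) (x 0 j)].
  have [s Ss] := IHn K' (replace_coord x i c) Kn.
  by move=> /(germ_in_replace _ _ _ _ _ iK') [? ?]; exists s.
have sep s s' c : S s -> S s' ->
    (forall j, j != i -> unit_interval_at (j \in K') (s 0 j) (x 0 j)) ->
    (forall j, j != i -> unit_interval_at (j \in K') (s' 0 j) (x 0 j)) ->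
    s 0 i <= c < s 0 i + 1 -> s' 0 i <= c < s' 0 i + 1 -> s 0 i = s' 0 i.
  move=> Ss Ss' Hs Hs' hc hc'; congr (fun_of_matrix _ _ _).
  by apply: (@germ_in_unique S K' _ _ (replace_coord x i c)) => //;
    apply/germ_in_replace.
have [s [Ss si Hs]] := cover (x 0 i).
have [sx|xs] := ltP (s 0 i) (x 0 i).
  by exists s => //; rewrite EK; apply/germ_in_setU1 => //; split=> //; lra.
(* Here [s 0 i = x 0 i], so a cube ending at [x 0 i] is wanted; it has to contain [x 0 i - 1]. *)
have [s1 [Ss1 s1i Hs1]] := cover (x 0 i - 1).
have [xs1|s1x] := leP (x 0 i) (s1 0 i + 1).
  by exists s1 => //; rewrite EK; apply/germ_in_setU1 => //; split=> //; lra.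
(* If [s1] ended before [x 0 i], its successor [s2] would start where [s1] ends and still contain
   [x 0 i], clashing with [s], which starts only there. *)
have [s2 [Ss2 s2i Hs2]] := cover (s1 0 i + 1).
have s2_ge : s1 0 i + 1 <= s2 0 i.
  rewrite leNgt; apply/negP => lt.
  by have := sep s1 s2 (s2 0 i) Ss1 Ss2 Hs1 Hs2; lra.
by have := sep s s2 (x 0 i) Ss Ss2 Hs Hs2; lra.
Qed.

Lemma germ_in_toggle K s x i : germ_in K s x -> s 0 i < x 0 i < s 0 i + 1 ->
  germ_in (toggle _ i K) s x.
Proof.
move=> H Hi j; move: (H j); rewrite inE.
case: (eqVneq j i) => [->|_]; last by rewrite addbF.
by move=> _; rewrite /unit_interval_at; case: ifP => _; lra.
Qed.

Lemma germ_in_corner K s x i : germ_in K s x ->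
  ~~ (s 0 i < x 0 i < s 0 i + 1) -> s 0 i = x 0 i - (i \in K)%:R.
Proof. by move=> /(_ i); rewrite /unit_interval_at; case: (i \in K) => /=; lra. Qed.

Lemma opposite_parity_corner S p K0 : cube_tiling S -> (0 < d)%N ->
    S (\row_i (p 0 i - (i \in K0)%:R)) ->
  exists2 K : {set 'I_d}, odd #|K| != odd #|K0| &
    S (\row_i (p 0 i - (i \in K)%:R)).
Proof.
move=> hS d_gt0 SK0; pose i0 := Ordinal d_gt0.
have /choice[f Hf] : forall K, exists s, S s /\ germ_in K s p.
  by move=> K; have [s] := germ_in_exists S K p hS; exists s.
pose free s := [pick i | s 0 i < p 0 i < s 0 i + 1].
pose corner K := free (f K) == None.
pose w K : int := (-1) ^+ odd #|K|.
have w_toggle i K : w (toggle _ i K) = - w K.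
  by rewrite /w odd_toggle signrN.
have cornerS K : corner K -> S (\row_i (p 0 i - (i \in K)%:R)).
  rewrite /corner /free; case: pickP => // nofree _.
  suff <- : f K = \row_i (p 0 i - (i \in K)%:R) by have [] := Hf K.
  apply/rowP => i; rewrite mxE; apply: germ_in_corner; first by have [] := Hf K.
  by rewrite nofree.
(* By uniqueness [f K0] is the given cube, and [p] is a vertex of it. *)
have cornerK0 : corner K0.
  have -> // : corner K0 = (free (\row_i (p 0 i - (i \in K0)%:R)) == None).
    rewrite /corner; congr (free _ == None); have [Sf fK0] := Hf K0.
    apply: (germ_in_unique S K0 _ _ p) => // i.
    by rewrite mxE /unit_interval_at; case: (i \in K0) => /=; lra.
  rewrite /free; case: pickP => // i; rewrite mxE.
  by case: (i \in K0) => /=; lra.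
(* Toggling the fixed direction [i0], available as [d] is positive, pairs off all signs. *)
have sum_all : \sum_K w K = 0.
  by apply: (sum_sign_reversing _ _ _ (toggle _ i0)) => //; exact: toggleK.
(* The toggled direction depends on [K] only through [f K], which [g] preserves; this makes [g] an
   involution. *)
pose g K := if free (f K) is Some i then toggle _ i K else K.
have fg K : f (g K) = f K.
  rewrite /g /free; case: pickP => // i Hi.
  have [Sf H] := Hf K; have [Sf' H'] := Hf (toggle _ i K).
  by apply: (germ_in_unique S (toggle _ i K) _ _ p) => //; exact: germ_in_toggle.
have sum_noncorner : \sum_(K | ~~ corner K) w K = 0.
  apply: (sum_sign_reversing _ _ _ g).
  - move=> K; rewrite {1}/g fg /g.
    by case: (free (f K)) => // i; rewrite toggleK.
  - by move=> K; rewrite /corner fg.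
  - by move=> K; rewrite /corner /g; case: (free (f K)).
have sum_corner : \sum_(K | corner K) w K = 0.
  by move: sum_all; rewrite (bigID corner) /= sum_noncorner addr0.
have [/existsP[K /andP[cK oK]]|] :=
    boolP [exists K, corner K && (odd #|K| != odd #|K0|)].
  by exists K => //; exact: cornerS.
rewrite negb_exists => /forallP same.
(* With all corners of the same parity nothing cancels, and [K0] makes the count nonzero. *)
have : \sum_(K | corner K) w K = w K0 *+ #|corner|.
  rewrite -sumr_const; apply: eq_bigr => K cK; rewrite /w.
  by have := same K; rewrite cK /= negbK => /eqP ->.
rewrite sum_corner => /esym/eqP; rewrite mulrn_eq0 signr_eq0 orbF.
by move=> /eqP/card0_eq/(_ K0) E; move: cornerK0; rewrite -[corner K0]/(K0 \in corner) E.
Qed.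

End Orthants.

Theorem theorem4 (R : realType) (d : nat) (hd : (1 <= d)%N)
    (S : set 'rV[R]_d) (hS : cube_tiling S)
    (t : 'rV[R]_d) (ht : S t)
    (eps : 'I_d -> R) (heps : forall i, eps i = -1 \/ eps i = 1) :
  exists J : {set 'I_d},
    odd #|J| /\ S (t + \sum_(i in J) eps i *: delta_mx 0 i).
Proof.
(* [p] is the vertex of the cube at [t] towards [eps], so that [t] is [p] lowered by 1 in the
   directions of [K0]. *)
pose K0 : {set 'I_d} := [set i | eps i == 1]%SET.
pose p : 'rV[R]_d := \row_i (t 0 i + (i \in K0)%:R).
have [|K oK SK] := opposite_parity_corner R d S p K0 hS hd.
  by congr (S _): ht; apply/rowP => i; rewrite !mxE addrK.
(* Passing from [K0] to [K] adds 1 on [K0] minus [K] and subtracts 1 on [K] minus [K0], which is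
   [eps i] in both cases. *)
exists [set i | (i \in K) (+) (i \in K0)]%SET; split.
  by rewrite odd_symdiff; case: (odd _) oK; case: (odd _).
congr (S _): SK; apply/rowP => i; rewrite !mxE summxE.
under eq_bigr => j _ do rewrite !mxE eqxx /= eq_sym mulr_natr mulrb.
rewrite -big_mkcondr /= -addrA; congr (_ + _).
have [iJ|iJ] := boolP (i \in [set i | (i \in K) (+) (i \in K0)]%SET).
  rewrite (big_pred1 i) => [|j]; last first.
    by rewrite /=; case: (eqVneq j i) => [->|_]; rewrite ?iJ ?andbF.
  move: iJ; rewrite !inE; case: (i \in K); case: eqP => //= Hi _; last by lra.
  by case: (heps i) => [->|/Hi []]; lra.
rewrite big_pred0 => [|j]; last first.
  by case: (eqVneq j i) => [->|_]; rewrite ?(negbTE iJ) ?andbF.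
by move: iJ; rewrite !inE; case: (i \in K); case: eqP => //= _ _; lra.
Qed.
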